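(* Let $\mathcal{K}=\{x\in\mathbb{R}^n : g_i(x)\ge 0,\ i=1,\dots,m\}$, where $g_1,\dots,g_m$ are real multivariate polynomials, be compact with non-empty interior, and let $\mathcal{B}=\{x\in\mathbb{R}^n : a_i\le x_i\le b_i,\ i=1,\dots,n\}$ be a hyperrectangle with $\mathcal{B}\supseteq\mathcal{K}$. For $d\in\mathbb{N}$ let $$v_d^* := \inf\{\mathrm{vol}\,\mathcal{U}(p) : p\in P_d,\ \mathcal{K}\subseteq\mathcal{U}(p)\},$$ $$w_d^* := \inf\Big\{\int_{\mathcal{B}}p(x)\,dx : p\in P_d,\ p\ge 0 \text{ on } \mathcal{B},\ p\ge 1\text{ on }\mathcal{K}\Big\}.$$ Then, for every $d\in\mathbb{N}$, the infimum defining $w_d^*$ is attained by some polynomial $p_d^*\in P_d$ (feasible for that problem). Moreover, $w_d^*\ge v_d^*$ and $\mathcal{U}(p_d^* )\supseteq\mathcal{K}$. Finally, $w_d^*\ge w_{d+1}^*$ and $$\lim_{d\to\infty}w_d^*=\lim_{d\to\infty}v_d^*=\mathrm{vol}\,\mathcal{K}.$$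
   Context: $P_d$ denotes the set of real polynomials in $n$ variables of degree at most $d$. For a polynomial $p$, the polynomial superlevel set is $\mathcal{U}(p):=\{x\in\mathcal{B} : p(x)\ge 1\}$. $\mathrm{vol}$ denotes Lebesgue measure on $\mathbb{R}^n$. For $p$ nonnegative on $\mathcal{B}$, the integral $\int_{\mathcal{B}}p(x)\,dx$ is the $L^1$ norm of $p$ on $\mathcal{B}$. *)

(* Defs.v *)
From HB Require Import structures.
From mathcomp Require Import all_boot all_order all_algebra.
(* Without its notations, which clash with those of mathcomp-analysis. *)
From mathcomp Require Import -(notations) mpoly.
From mathcomp Require Import all_classical all_reals all_analysis.
Import Order.TTheory GRing.Theory Num.Theory.
Import numFieldNormedType.Exports.

Set Implicit Arguments.
Unset Strict Implicit.
Unset Printing Implicit Defensive.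

Local Open Scope classical_set_scope.
Local Open Scope ring_scope.

(* The product sigma-algebra on R^n, i.e. the one generated by the coordinates
   (it is the Borel sigma-algebra of R^n, since R is second countable). *)
Section measurable_rV.
Variables (R : realType) (n : nat).

Definition coord_rV (i : 'I_n) (x : 'rV[R]_n) : measurableTypeR R := x ord0 i.

Let rV_set0 : g_sigma_preimage coord_rV set0.
Proof. exact: sigma_algebra0. Qed.

Let rV_setC A : g_sigma_preimage coord_rV A -> g_sigma_preimage coord_rV (~` A).
Proof. exact: sigma_algebraC. Qed.

Let rV_bigcup (F : (set 'rV[R]_n)^nat) :
  (forall i, g_sigma_preimage coord_rV (F i)) ->
  g_sigma_preimage coord_rV (\bigcup_i (F i)).
Proof. exact: sigma_algebra_bigcup. Qed.

Definition rV_display : measure_display.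
Proof. exact: (measure_tuple_display default_measure_display). Qed.

HB.instance Definition _ := @isMeasurable.Build rV_display
  'rV[R]_n (g_sigma_preimage coord_rV) rV_set0 rV_setC rV_bigcup.

End measurable_rV.

Section measurable_rV_lemmas.
Variable R : realType.

Lemma measurable_coord_rV n (i : 'I_n) :
  measurable_fun [set: 'rV[R]_n] (@coord_rV R n i).
Proof.
move=> _ Y mY; rewrite setTI; apply: sub_sigma_algebra => /=.
rewrite -bigcup_seq/=; exists i => /=; first by rewrite mem_index_enum.
by exists Y => //; rewrite setTI.
Qed.

Lemma measurable_fun_rV d (T : measurableType d) n (f : T -> 'rV[R]_n) :
  (forall i, measurable_fun setT (coord_rV i \o f)) -> measurable_fun setT f.
Proof.
move=> mf _ Y mY; rewrite setTI.
suff : g_sigma_preimage (fun i => @coord_rV R n i \o f) `<=` measurable.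
  by rewrite g_sigma_preimage_comp; apply; exists Y => //; rewrite setTI.
apply: smallest_sub; first exact: sigma_algebra_measurable.
rewrite -bigcup_seq => A [i _ [B mB <-]]; exact: mf.
Qed.

Definition cons_rV n (z : measurableTypeR R * 'rV[R]_n) : 'rV[R]_n.+1 :=
  row_mx (z.1%:M : 'rV[R]_1) z.2.

Definition uncons_rV n (x : 'rV[R]_n.+1) : measurableTypeR R * 'rV[R]_n :=
  (x ord0 ord0, \row_j x ord0 (lift ord0 j)).

Lemma coord_cons0 n (z : measurableTypeR R * 'rV[R]_n) :
  (cons_rV z) ord0 ord0 = z.1.
Proof.
rewrite /cons_rV mxE; case: splitP => [j|j //]; rewrite ord1 => _.
by rewrite mxE eqxx mulr1n.
Qed.

Lemma coord_consS n (z : measurableTypeR R * 'rV[R]_n) (i : 'I_n) :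
  (cons_rV z) ord0 (lift ord0 i) = z.2 ord0 i.
Proof.
rewrite /cons_rV mxE; case: splitP => [j|j]; first by rewrite ord1.
by rewrite lift0 add1n => -[] /val_inj ->.
Qed.

Lemma cons_rVK n : cancel (@cons_rV n) (@uncons_rV n).
Proof.
move=> [t y]; rewrite /uncons_rV coord_cons0; congr pair.
by apply/rowP => i; rewrite mxE coord_consS.
Qed.

Lemma measurable_cons_rV n : measurable_fun setT (@cons_rV n).
Proof.
apply: measurable_fun_rV => i.
have [j ->|->] := unliftP ord0 i.
- rewrite (_ : _ \o _ = coord_rV j \o snd).
    by apply: measurableT_comp => //; exact: measurable_coord_rV.
  by apply/funext => z /=; rewrite /coord_rV coord_consS.
- rewrite (_ : _ \o _ = fst); first exact: measurable_fst.
  by apply/funext => z /=; rewrite /coord_rV coord_cons0.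
Qed.

Lemma measurable_uncons_rV n : measurable_fun setT (@uncons_rV n).
Proof.
apply/measurable_fun_pairP; split.
- exact: (measurable_coord_rV (ord0 : 'I_n.+1)).
- apply: measurable_fun_rV => i.
  rewrite (_ : _ \o _ = coord_rV (lift ord0 i)); first exact: measurable_coord_rV.
  by apply/funext => x; rewrite /coord_rV /= mxE.
Qed.

End measurable_rV_lemmas.

(* From Lebesgue measure mu on R^n to Lebesgue measure on R^(n+1). The sigma-finite
   instance is proved by hand: the one of the library for \x is not inferred for
   infinite measures (its canonical path goes through sub-probabilities). *)
Section lebesgue_step.
Variables (R : realType) (n : nat).
Variable mu : {sigma_finite_measure set 'rV[R]_n -> \bar R}.

Definition lebesgue_step :=
  pushforward ((@lebesgue_measure R) \x mu)%E (@cons_rV R n).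

HB.instance Definition _ := Measure.copy lebesgue_step
  (measure_function_pushforward__canonical__measure_function_Measure
     ((@lebesgue_measure R) \x mu)%E (@measurable_cons_rV R n)).

Let lebesgue_step_sigma_finite : sigma_finite setT lebesgue_step.
Proof.
have /sigma_finiteP[F [TF ndF Foo]] := sigma_finiteT (@lebesgue_measure R).
have /sigma_finiteP[G [TG ndG Goo]] := sigma_finiteT mu.
exists (fun k => @uncons_rV R n @^-1` (F k `*` G k)).
  apply/esym; rewrite -subTset => x _.
  have [i _ Fi] : (\bigcup_i F i) (uncons_rV x).1 by rewrite -TF.
  have [j _ Gj] : (\bigcup_i G i) (uncons_rV x).2 by rewrite -TG.
  exists (maxn i j) => //; split.
  - by move: Fi; exact/subsetPset/ndF/leq_maxl.
  - by move: Gj; exact/subsetPset/ndG/leq_maxr.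
move=> k; have [mF Fk] := Foo k; have [mG Gk] := Goo k.
have mFG : measurable (F k `*` G k) by exact: measurableX.
split; first by rewrite -[X in measurable X]setTI; exact: measurable_uncons_rV.
rewrite /lebesgue_step /pushforward -comp_preimage.
rewrite (_ : _ \o _ = id); last by apply/funext => z /=; rewrite cons_rVK.
by rewrite preimage_id product_measure1E// lte_mul_pinfty// ge0_fin_numE.
Qed.

HB.instance Definition _ := Measure_isSigmaFinite.Build _ _ _ lebesgue_step
  lebesgue_step_sigma_finite.

End lebesgue_step.

(* n-dimensional Lebesgue measure, as an iterated product on the Borel sets;
   R^0 is a point of mass 1. *)
Fixpoint vol (R : realType) (n : nat) :
    {sigma_finite_measure set 'rV[R]_n -> \bar R} :=
  match n with
  | 0 => \d_(0 : 'rV[R]_0)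
  | k.+1 => lebesgue_step (vol R k)
  end.

Definition box (R : realType) (n : nat) (a b : 'rV[R]_n) : set 'rV[R]_n :=
  [set x | forall i, a ord0 i <= x ord0 i <= b ord0 i].

Lemma vol_box (R : realType) (n : nat) (a b : 'rV[R]_n) :
  (forall i, a ord0 i <= b ord0 i) ->
  vol R n (box a b) = (\prod_(i < n) (b ord0 i - a ord0 i))%:E.
Proof.
elim: n a b => [|n IHn] a b ab.
  by rewrite big_ord0 /= diracE mem_set // => -[].
pose tl (x : 'rV[R]_n.+1) := (uncons_rV x).2.
have mbox k (u v : 'rV[R]_k) : measurable (box u v).
  rewrite (_ : box u v = \big[setI/setT]_(i < k)
      (@coord_rV R k i @^-1` `[u ord0 i, v ord0 i]%classic)).
    apply: bigsetI_measurable => i _.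
    by rewrite -[X in measurable X]setTI; apply: measurable_coord_rV.
  rewrite -bigcap_seq; apply/seteqP; split=> x /= H i.
    by move=> _; rewrite /= in_itv; exact: H.
  by have := H i (mem_index_enum i); rewrite /= in_itv.
rewrite /= /lebesgue_step /pushforward.
rewrite (_ : _ @^-1` _ = `[a ord0 ord0, b ord0 ord0] `*` box (tl a) (tl b)).
  rewrite product_measure1E //; last exact: mbox.
  rewrite [X in (_ * X)%E]IHn; last by move=> i; rewrite !mxE.
  rewrite [X in (X * _)%E]lebesgue_measure_itv /= lte_fin big_ord_recl /=.
  have := ab ord0; rewrite le_eqVlt => /orP[/eqP ->|lt_ab].
    by rewrite ltxx mul0e subrr mul0r.
  rewrite lt_ab -EFinB -EFinM; congr ((_ * _)%:E).
  by apply: eq_bigr => i _; rewrite !mxE.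
apply/seteqP; split=> -[t y] /= H.
  split=> [|i]; first by have := H ord0; rewrite coord_cons0 in_itv.
  by have := H (lift ord0 i); rewrite coord_consS !mxE.
case: H => Ht Hy i; have [j ->|->] := unliftP ord0 i.
  by have := Hy j; rewrite coord_consS !mxE.
by move: Ht; rewrite coord_cons0 in_itv.
Qed.

(* The space P_d of polynomials of degree at most d; msize is one more than the
   total degree, and msize 0 = 0. *)
Definition Pd (R : realType) (n d : nat) : set (mpoly n R) :=
  [set p | (msize p <= d.+1)%N].

Definition peval (R : realType) (n : nat) (p : mpoly n R)
    (x : 'rV[R]_n) : R :=
  meval (fun i => x ord0 i) p.

Definition semialg (R : realType) (n m : nat) (g : 'I_m -> mpoly n R) :
    set 'rV[R]_n :=
  [set x | forall i, 0 <= peval (g i) x].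

Definition superlevel (R : realType) (n : nat) (B : set 'rV[R]_n)
    (p : mpoly n R) : set 'rV[R]_n :=
  [set x | B x /\ 1 <= peval p x].

Definition v_feasible (R : realType) (n : nat) (K B : set 'rV[R]_n) (d : nat)
    (p : mpoly n R) : Prop :=
  Pd d p /\ K `<=` superlevel B p.

Definition w_feasible (R : realType) (n : nat) (K B : set 'rV[R]_n) (d : nat)
    (p : mpoly n R) : Prop :=
  [/\ Pd d p, forall x, B x -> 0 <= peval p x &
      forall x, K x -> 1 <= peval p x].

Definition w_objective (R : realType) (n : nat) (B : set 'rV[R]_n)
    (p : mpoly n R) : \bar R :=
  (\int[vol R n]_(x in B) (peval p x)%:E)%E.

(* Infima are taken in \bar R: both feasible sets contain the constant 1 and have
   finite objective at it when B is a box containing K, so the values are finite. *)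
Definition v_star (R : realType) (n : nat) (K B : set 'rV[R]_n) (d : nat) :
    \bar R :=
  ereal_inf [set vol R n (superlevel B p) | p in v_feasible K B d].

Definition w_star (R : realType) (n : nat) (K B : set 'rV[R]_n) (d : nat) :
    \bar R :=
  ereal_inf [set w_objective B p | p in w_feasible K B d].

(* Main.v *)
Require Import Defs.
From mathcomp Require Import all_boot all_order all_algebra.
From mathcomp Require Import -(notations) mpoly.
From mathcomp Require Import all_classical all_reals all_analysis.
From mathcomp Require Import measurable_realfun ring lra.
Import Order.TTheory GRing.Theory Num.Theory.
Import numFieldNormedType.Exports.

(** Write K for the semialgebraic set and B for the box.

   Attainment. On the coefficient space of P_d the objective is a linear form,
   and the feasible polynomials form a closed subset of the closed cone C of the
   polynomials that are nonnegative on B. The form is positive on C minus 0: a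
   nonzero polynomial is nonzero somewhere in the interior of K, because a
   polynomial that vanishes on a nonempty open set is 0 ([peval_eq0_on_open]);
   being nonnegative, it is then bounded below by a positive constant on a small
   box, of positive volume ([w_objective_gt0]). By compactness of the unit sphere
   of C the form dominates a multiple of the l1 norm of the coefficients, so
   minimizing it over the feasible set amounts to minimizing over a compact set
   ([linear_form_min]).

   Values. For p nonnegative on B, Markov's inequality bounds the volume of the
   superlevel set of p by the integral of p, hence vol K <= v_d <= w_d, and w_d is
   nonincreasing in d since feasibility is preserved when d grows. It remains to
   find feasible polynomials, of any degrees, whose integrals tend to vol K.

   Approximation. No general density theorem is needed, because K is described by
   polynomial inequalities: it suffices to approximate from above the step function
   of one real variable t in [-1, 1] that is 1 for t >= 0 and 0 for t < 0. With
   u = (1 - t) / 2, which is at most 1/2 exactly when t >= 0, the polynomial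
   (1 - u ^ (j^2)) ^ (2 ^ (j^2 - j)) + 2 ^ -j does this ([step], [step_ge1],
   [step_cvg]), by two forms of Bernoulli's inequality. Composing it with each
   constraint, rescaled to take values in [-1, 1] on B, and multiplying the results
   gives polynomials that are at least 1 on K, nonnegative and uniformly bounded on
   B, and that converge pointwise on B to the indicator of K
   ([outer_approximation]). Their integrals tend to vol K by dominated convergence
   ([w_objective_cvg]). *)

Set Implicit Arguments.
Unset Strict Implicit.

Local Open Scope classical_set_scope.
Local Open Scope ring_scope.

(** * Polynomial functions on R^n *)

(** Properties of polynomial functions such as continuity or measurability are
   stable under sums and products; this induction principle asks for nothing
   about monomials or supports. *)
Lemma mpoly_alg_ind (n : nat) (R : comNzRingType) (P : mpoly n R -> Prop) :
  (forall c, P (mpolyC n c)) -> (forall i, P (mpolyX R (mnm1 i))) ->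
  (forall p q, P p -> P q -> P (p + q)) ->
  (forall p q, P p -> P q -> P (p * q)) -> forall p, P p.
Proof.
move=> PC PX PD PM; elim/mpolyind => [|c m p _ _ Pp]; first by rewrite -mpolyC0.
apply: (PD) => //; rewrite -mul_mpolyC; apply: (PM) => //.
rewrite mpolyXE_id; elim/big_ind: _ => [|q r|i _]; [exact: (PC 1)|exact: PM|].
by elim: (m i) => [|k IHk]; rewrite ?exprS; [exact: (PC 1)|exact: PM].
Qed.

Section peval.
Variables (R : realType) (n : nat).
Implicit Types (p q : mpoly n R) (x : 'rV[R]_n).

Lemma pevalC c x : peval (mpolyC n c) x = c.
Proof. exact: mevalC. Qed.
Lemma pevalX i x : peval (mpolyX R (mnm1 i)) x = x ord0 i.
Proof. exact: mevalXU. Qed.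
Lemma pevalD p q x : peval (p + q) x = peval p x + peval q x.
Proof. exact: mevalD. Qed.
Lemma pevalB p q x : peval (p - q) x = peval p x - peval q x.
Proof. exact: mevalB. Qed.
Lemma pevalM p q x : peval (p * q) x = peval p x * peval q x.
Proof. exact: mevalM. Qed.
Lemma pevalZ c p x : peval (c *: p) x = c * peval p x.
Proof. exact: mevalZ. Qed.
Lemma peval_sum (I : Type) (r : seq I) (F : I -> mpoly n R) x :
  peval (\sum_(i <- r) F i) x = \sum_(i <- r) peval (F i) x.
Proof. exact: raddf_sum. Qed.
Lemma peval_prod (I : Type) (r : seq I) (F : I -> mpoly n R) x :
  peval (\prod_(i <- r) F i) x = \prod_(i <- r) peval (F i) x.
Proof. exact: rmorph_prod. Qed.
Lemma pevalXn p k x : peval (p ^+ k) x = peval p x ^+ k.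
Proof. exact: rmorphXn. Qed.

Lemma peval_continuous p : continuous (peval p).
Proof.
elim/mpoly_alg_ind: p => [c|i|p q cp cq|p q cp cq].
- by rewrite (funext (pevalC c)) ; exact: cst_continuous.
- by rewrite (funext (pevalX i)); exact: coord_continuous.
- by rewrite (funext (pevalD p q)) => x; exact: (continuousD (cp x) (cq x)).
- by rewrite (funext (pevalM p q)) => x; exact: (continuousM (cp x) (cq x)).
Qed.

Lemma measurable_peval p : measurable_fun setT (peval p).
Proof.
elim/mpoly_alg_ind: p => [c|i|p q mp mq|p q mp mq].
- by rewrite (funext (pevalC c)); exact: measurable_cst.
- by rewrite (funext (pevalX i)); exact: measurable_coord_rV.
- by rewrite (funext (pevalD p q)); exact: measurable_funD.
- by rewrite (funext (pevalM p q)); exact: measurable_funM.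
Qed.

Lemma compact_box (a b : 'rV[R]_n) : compact (box a b).
Proof.
rewrite (_ : box a b =
  [set x | forall i, `[a ord0 i, b ord0 i]%classic (x ord0 i)]).
  by apply: (rV_compact (A := fun i => `[a ord0 i, b ord0 i]%classic)) => i;
    exact: segment_compact.
by apply/seteqP; split=> x /= xab i; have := xab i; rewrite in_itv.
Qed.

Lemma bounded_peval_box (a b : 'rV[R]_n) p :
  exists2 M, 0 < M & forall x, box a b x -> `|peval p x| <= M.
Proof.
have /ex_strict_bound_gt0[M M0 HM] : bounded_set (peval p @` box a b).
  apply/compact_bounded/continuous_compact; last exact: compact_box.
  exact/continuous_subspaceT/peval_continuous.
by exists M => // x xB; apply/ltW/HM; exact: imageP.
Qed.

(** Working along a coordinate line keeps the argument within the differential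
   calculus of one real variable, where the product rule mirrors that of
   [mderiv]. *)
Lemma is_derive_peval p x (i : 'I_n) (t : R) :
  is_derive t 1 (fun s : R => peval p (x + s *: delta_mx ord0 i))
    (peval (mderiv i p) (x + t *: delta_mx ord0 i)).
Proof.
elim/mpoly_alg_ind: p => [c|j|p q dp dq|p q dp dq].
- rewrite mderivC -mpolyC0 pevalC (_ : (fun s => _) = cst c).
    exact: is_derive_cst.
  by apply/funext => s; rewrite pevalC.
- rewrite mderivX pevalZ mnm1E.
  have -> : (j == i)%:R * peval (mpolyX R (mnm_sub (mnm1 j) (mnm1 i)))
      (x + t *: delta_mx ord0 i) = (j == i)%:R :> R.
    have [->|] := eqVneq j i; last by rewrite mul0r.
    by rewrite (_ : mnm_sub _ _ = mnm0) ?mpolyX0 ?[peval 1 _]meval1 ?mul1r//;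
      apply/mnmP => k; rewrite mnmBE subnn mnm0E.
  have -> : (fun s : R => peval (mpolyX R (mnm1 j)) (x + s *: delta_mx ord0 i))
      = cst (x ord0 j) + (j == i)%:R *: (id : R -> R).
    apply/funext => s; rewrite pevalX !mxE eqxx /=.
    by rewrite /GRing.scale /= mulrC.
  have dc := is_derive_cst (x ord0 j) t (1 : R).
  have dz := is_deriveZ (j == i)%:R (is_derive_id t (1 : R)).
  apply: is_derive_eq (is_deriveD dc dz) _.
  by rewrite add0r /GRing.scale /= mulr1.
- rewrite mderivD pevalD (_ : (fun s => _) =
    (fun s => peval p (x + s *: delta_mx ord0 i)) +
    (fun s => peval q (x + s *: delta_mx ord0 i))).
    exact: is_deriveD.
  by apply/funext => s; rewrite pevalD.
- rewrite mderivM pevalD !pevalM (_ : (fun s => _) =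
    (fun s => peval p (x + s *: delta_mx ord0 i)) *
    (fun s => peval q (x + s *: delta_mx ord0 i))).
    apply: is_derive_eq (is_deriveM dp dq) _.
    by rewrite /GRing.scale /= addrC [X in X + _]mulrC.
  by apply/funext => s; rewrite pevalM.
Qed.

(** Along a coordinate line through a point of U the polynomial is locally
   constant. *)
Lemma mderiv_eq0_on_open p (U : set 'rV[R]_n) (i : 'I_n) : open U ->
  (forall x, U x -> peval p x = 0) -> forall x, U x -> peval (mderiv i p) x = 0.
Proof.
move=> oU p0 x Ux.
pose l (t : R) : 'rV[R]_n := x + t *: delta_mx ord0 i.
have l0 : l 0 = x by rewrite /l scale0r addr0.
have nU : \forall t \near (0 : R), U (l t).
  have /nbhs_ballP[e /= e0 eU] : nbhs x U by exact: open_nbhs_nbhs.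
  apply/nbhs_ballP; exists e => // t; rewrite /ball /= sub0r normrN => te.
  apply: eU; split=> // u v; rewrite /l /ball /= !mxE opprD addNKr normrN.
  apply: le_lt_trans te; rewrite normrM ler_piMr// normr_nat.
  by case: (_ && _); rewrite ?lexx ?ler01.
have h := is_derive_peval p x i 0; rewrite -/(l 0) l0 in h.
rewrite -(@derive_val _ _ _ _ _ _ _ h) -[RHS](derive_cst (0 : R) (0 : R) (1 : R)).
by apply: near_eq_derive; apply: filterS nU => t /p0.
Qed.

(** The partial derivatives of p vanish on U too and have smaller degree, so they
   are 0 by induction; in characteristic 0 this forces p to be constant. *)
Lemma peval_eq0_on_open p (U : set 'rV[R]_n) : open U -> U !=set0 ->
  (forall x, U x -> peval p x = 0) -> p = 0.
Proof.
move=> oU [x0 Ux0].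
(* Bounding the degree through the vanishing of coefficients makes the bound for
   the derivatives immediate. *)
suff H k q : (forall m, (k <= mdeg m)%N -> mcoeff m q = 0) ->
    (forall x, U x -> peval q x = 0) -> q = 0.
  apply: (H (msize p)) => m pm; apply/eqP.
  by rewrite mcoeff_eq0 msize_mdeg_ge.
elim: k q => [|k IHk] {}p pk p0.
  by apply/mpolyP => m; rewrite mcoeff0 pk.
have dp0 i : mderiv i p = 0.
  apply: IHk => [m km|]; last exact: mderiv_eq0_on_open p0.
  by rewrite mcoeff_deriv pk ?mul0rn// mdegD mdeg1 addn1.
have pc : p = mpolyC n (mcoeff mnm0 p).
  apply/mpolyP => m; rewrite mcoeffC.
  have [->|/eqP] := eqVneq m mnm0; first by rewrite mulr1.
  rewrite mulr0 => m0.
  have [i mi] : exists i, (0 < m i)%N.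
    apply/not_existsP => h; apply: m0; apply/mnmP => i; rewrite mnm0E.
    by have /negP := h i; rewrite lt0n negbK => /eqP.
  have := congr1 (mcoeff (mnm_sub m (mnm1 i))) (dp0 i).
  rewrite mcoeff_deriv mcoeff0 submK; last first.
    by apply/mnm_lepP => j; rewrite mnm1E; case: eqP => // <-.
  by move/eqP; rewrite mulrn_eq0 /= => /eqP.
by have := p0 _ Ux0; rewrite pc pevalC => ->; rewrite mpolyC0.
Qed.

End peval.

(** * Minimizing a linear form over a closed part of a cone *)

Section linear_minimum.
Variables (R : realType) (N : nat).
Implicit Types (c : 'rV[R]_N).

Lemma continuous_sum (T : topologicalType) (I : Type) (r : seq I)
    (f : I -> T -> R) :
  (forall i, continuous (f i)) -> continuous (fun x => \sum_(i <- r) f i x).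
Proof.
move=> cf; elim: r => [|i r IHr].
  rewrite (_ : (fun x => _) = cst 0); first exact: cst_continuous.
  by apply/funext => x; rewrite big_nil.
rewrite (_ : (fun x => _) = f i \+ (fun x => \sum_(i <- r) f i x)).
  by move=> x; exact: (continuousD (cf i x) (IHr x)).
by apply/funext => x; rewrite big_cons.
Qed.

Lemma linear_form_continuous (mu : 'I_N -> R) :
  continuous (fun c : 'rV[R]_N => \sum_i c ord0 i * mu i).
Proof.
apply: continuous_sum => i c.
exact: (continuousM (@coord_continuous R _ _ ord0 i c)
  (@cst_continuous _ _ (mu i) c)).
Qed.

Let l1 c := \sum_i `|c ord0 i|.

Let l1_continuous : continuous l1.
Proof.
apply: continuous_sum => i c.
exact: (cvg_norm (@coord_continuous R _ _ ord0 i c)).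
Qed.

Let coord_le_l1 c i : `|c ord0 i| <= l1 c.
Proof. by rewrite /l1 (bigD1 i)//= lerDl sumr_ge0. Qed.

Let compact_cube (A : set 'rV[R]_N) (T : R) : closed A ->
  (forall c, A c -> l1 c <= T) -> compact A.
Proof.
move=> cA AT.
pose cube := [set c : 'rV[R]_N | forall i, `[-T, T]%classic (c ord0 i)].
apply: (@subclosed_compact _ _ cube) => //.
  by apply: (rV_compact (A := fun=> `[-T, T]%classic)) => i; exact: segment_compact.
move=> c Ac i; rewrite /= in_itv /= -ler_norml.
by rewrite (le_trans (coord_le_l1 c i))// AT.
Qed.

(** A linear form that is positive on a closed cone minus 0 is coercive on that
   cone: it is at least s times the l1 norm, where s > 0 is its minimum on the
   unit sphere of the cone. Outside the compact part of F where the norm is at most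
   L f0 / s, the form therefore exceeds its value at a chosen point f0 of F. *)
Lemma linear_form_min (mu : 'I_N -> R) (C F : set 'rV[R]_N) :
  closed C -> (forall k c, 0 <= k -> C c -> C (k *: c)) ->
  (forall c, C c -> c != 0 -> 0 < \sum_i c ord0 i * mu i) ->
  closed F -> F !=set0 -> F `<=` C ->
  exists2 c, F c & forall c', F c' ->
    \sum_i c ord0 i * mu i <= \sum_i c' ord0 i * mu i.
Proof.
move=> cC Ccone Lpos cF [f0 Ff0] FC.
pose L := fun c : 'rV[R]_N => \sum_i c ord0 i * mu i.
change (exists2 c, F c & forall c', F c' -> L c <= L c').
have Lc : continuous L by exact: linear_form_continuous.
have LZ k c : L (k *: c) = k * L c.
  by rewrite /L mulr_sumr; apply: eq_bigr => i _; rewrite mxE mulrA.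
have L0 : L 0 = 0 by rewrite /L big1// => i _; rewrite mxE mul0r.
have L_ge0 c : C c -> 0 <= L c.
  move=> Cc; have [->|c0] := eqVneq c 0; last exact/ltW/Lpos.
  by rewrite L0.
have l10 c : (l1 c == 0) = (c == 0).
  apply/eqP/eqP => [c0|->]; last by rewrite /l1 big1// => i _; rewrite mxE normr0.
  apply/rowP => i; rewrite mxE; apply/eqP; rewrite -normr_le0 -c0.
  exact: coord_le_l1.
have [f00|f0n0] := eqVneq f0 0.
  by exists f0 => // c' /FC /L_ge0; rewrite f00 L0.
have l1f0 : 0 < l1 f0 by rewrite lt_def l10 f0n0 sumr_ge0.
have l1Z k c : 0 <= k -> l1 (k *: c) = k * l1 c.
  move=> k0; rewrite /l1 mulr_sumr; apply: eq_bigr => i _.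
  by rewrite mxE normrM ger0_norm.
have [s [Cs s1] smin] : exists2 s, (C s /\ l1 s = 1) &
    forall c, C c -> l1 c = 1 -> L s <= L c.
  have [||s /set_mem[Cs s1] smin] :=
      @EVT_min_rV R N L (C `&` l1 @^-1` [set 1]) _ _ (continuous_subspaceT Lc).
  - exists ((l1 f0)^-1 *: f0); split.
      by apply: Ccone (FC _ Ff0); rewrite invr_ge0 ltW.
    by rewrite /= l1Z ?invr_ge0 ?ltW// mulVf// gt_eqF.
  - apply: (@compact_cube _ 1) => [|c [_ ->]//].
    apply: closedI => //; move/continuous_closedP: l1_continuous; apply.
    exact: closed_eq.
  - by exists s => // c Cc c1; apply: smin; rewrite inE.
have s0 : 0 < L s by apply: Lpos => //; rewrite -l10 s1 oner_neq0.
have coer c : C c -> L s * l1 c <= L c.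
  move=> Cc; have [->|c0] := eqVneq c 0.
    by rewrite (eqP (_ : l1 0 == 0)) ?l10// mulr0 L0.
  have l1c : 0 < l1 c by rewrite lt_def l10 c0 sumr_ge0.
  rewrite -ler_pdivlMr// mulrC -LZ; apply: smin.
    by apply: Ccone => //; rewrite invr_ge0 ltW.
  by rewrite l1Z ?invr_ge0 ?ltW// mulVf// gt_eqF.
have [||c /set_mem[Fc _] cmin] :=
  @EVT_min_rV R N L (F `&` l1 @^-1` [set t | t <= L f0 / L s])
    _ _ (continuous_subspaceT Lc).
- by exists f0; split=> //=; rewrite ler_pdivlMr// mulrC coer//; exact: FC.
- apply: (@compact_cube _ (L f0 / L s)) => [|c []//].
  apply: closedI => //; move/continuous_closedP: l1_continuous; apply.
  exact: closed_le.
exists c => // c' Fc'.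
have [c's|sc'] := leP (l1 c') (L f0 / L s); first by apply: cmin; rewrite inE.
apply: (@le_trans _ _ (L f0)).
  apply: cmin; rewrite inE; split=> //=.
  by rewrite ler_pdivlMr// mulrC coer//; exact: FC.
apply: le_trans (coer _ (FC _ Fc')).
by rewrite mulrC -ler_pdivrMr// ltW.
Qed.

End linear_minimum.

(** * Integrals of polynomials over a box *)

Section measurability.
Variables (R : realType) (n : nat).
Implicit Types (p : mpoly n R) (a b x : 'rV[R]_n).

Lemma measurable_peval_ge p (c : R) : measurable [set x | c <= peval p x].
Proof.
rewrite (_ : mkset _ = setT `&` peval p @^-1` `[c, +oo[).
  by apply: measurable_peval => //; exact: measurable_itv.
by apply/seteqP; split => x /=; rewrite in_itv /= andbT => // -[].
Qed.

Lemma measurable_semialg m (g : 'I_m -> mpoly n R) : measurable (semialg g).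
Proof.
rewrite (_ : semialg g = \big[setI/setT]_(i < m) [set x | 0 <= peval (g i) x]).
  by apply: bigsetI_measurable => i _; exact: measurable_peval_ge.
rewrite -bigcap_seq; apply/seteqP; split=> x /= gx i.
  by move=> _; exact: gx.
by apply: gx; rewrite /= mem_index_enum.
Qed.

Lemma measurable_box a b : measurable (box a b).
Proof.
rewrite (_ : box a b = \big[setI/setT]_(i < n)
    (setT `&` @coord_rV R n i @^-1` `[a ord0 i, b ord0 i]%classic)).
  apply: bigsetI_measurable => i _.
  by apply: measurable_coord_rV => //; exact: measurable_itv.
rewrite -bigcap_seq; apply/seteqP; split=> x /= xab i.
  by move=> _; split=> //=; rewrite in_itv; exact: xab.
by have [|_ /=] := xab i; rewrite /= ?mem_index_enum ?in_itv.
Qed.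

Lemma measurable_superlevel a b p : measurable (superlevel (box a b) p).
Proof.
by apply: measurableI; [exact: measurable_box|exact: measurable_peval_ge].
Qed.

Lemma vol_box_lty a b : (vol R n (box a b) < +oo)%E.
Proof.
have [->|/set0P[x xab]] := eqVneq (box a b) set0; first by rewrite measure0.
by rewrite vol_box ?ltry// => i; case/andP: (xab i); exact: le_trans.
Qed.

Lemma integrable_peval a b p :
  (vol R n).-integrable (box a b) (EFin \o peval p).
Proof.
apply: measurable_bounded_integrable.
- exact: measurable_box.
- exact: vol_box_lty.
- by apply: measurable_funTS; exact: measurable_peval.
- have [M M0 pM] := bounded_peval_box a b p.
  by exists M; split; rewrite ?num_real// => T MT x /pM /le_trans; apply; exact: ltW.
Qed.

Lemma w_objectiveE a b p :
  w_objective (box a b) p = (Rintegral (vol R n) (box a b) (peval p))%:E.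
Proof.
by rewrite /Rintegral fineK//; apply: integrable_fin_num (integrable_peval a b p);
  exact: measurable_box.
Qed.

Lemma Rintegral_peval_sum a b (I : Type) (r : seq I) (c : I -> R)
    (q : I -> mpoly n R) :
  Rintegral (vol R n) (box a b) (peval (\sum_(i <- r) c i *: q i)) =
  \sum_(i <- r) c i * Rintegral (vol R n) (box a b) (peval (q i)).
Proof.
have mB := measurable_box a b.
elim: r => [|i r IHr].
  rewrite !big_nil -mpolyC0 (funext (pevalC _)).
  by rewrite Rintegral_cst// mul0r.
rewrite !big_cons (funext (pevalD _ _)) (RintegralD mB).
- congr (_ + _); last exact: IHr.
  by rewrite (funext (pevalZ _ _)) RintegralZl//; exact: integrable_peval.
- exact: integrable_peval.
- exact: integrable_peval.
Qed.

(** Markov's inequality at level 1. *)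
Lemma vol_superlevel_le a b p : (forall x, box a b x -> 0 <= peval p x) ->
  (vol R n (superlevel (box a b) p) <= w_objective (box a b) p)%E.
Proof.
move=> p0; have mB := measurable_box a b; have mU := measurable_superlevel a b p.
have mp : measurable_fun setT (EFin \o peval p).
  by apply/measurable_EFinP; exact: measurable_peval.
apply: (@le_trans _ _ (\int[vol R n]_(x in superlevel (box a b) p) (peval p x)%:E)%E).
  rewrite -[leLHS]mul1e -integral_cst//; apply: ge0_le_integral => //.
  - exact: measurable_funTS.
  - by move=> x []; rewrite lee_fin.
apply: ge0_subset_integral => //.
- exact: measurable_funTS.
- by move=> x [].
Qed.

(** A nonzero p is positive somewhere in U, hence exceeds some e > 0 on a whole box
   of positive volume contained in U. *)
Lemma w_objective_gt0 a b (U : set 'rV[R]_n) p : open U -> U !=set0 ->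
  U `<=` box a b -> (forall x, box a b x -> 0 <= peval p x) -> p != 0 ->
  (0 < w_objective (box a b) p)%E.
Proof.
move=> oU U0 Uab p0 pn0.
have [x Ux px] : exists2 x, U x & 0 < peval p x.
  apply: contrapT => /forall2NP h; move/eqP: pn0; apply.
  apply: peval_eq0_on_open oU U0 _ => x Ux; apply/eqP.
  rewrite eq_le p0 ?andbT; last exact: Uab.
  by have [//|/negP] := h x; rewrite -leNgt.
set e := peval p x / 2.
have e0 : 0 < e by rewrite divr_gt0.
have : nbhs x (U `&` [set y | e < peval p y]).
  apply: filterI; first exact: open_nbhs_nbhs.
  have epx : e < peval p x by rewrite /e; lra.
  exact: (cvgr_gt _ (@peval_continuous _ _ p x) e epx).
move=> /nbhs_ballP[r /= r0 rU].
pose u : 'rV[R]_n := \row_i (x ord0 i - r / 2).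
pose v : 'rV[R]_n := \row_i (x ord0 i + r / 2).
have uvU : box u v `<=` U `&` [set y | e < peval p y].
  move=> y yuv; apply: rU; split=> // i j; rewrite ord1 /ball /=.
  have := yuv j; rewrite !mxE -ler_distl distrC => /le_lt_trans; apply.
  by rewrite ltr_pdivrMr// ltr_pMr// ltr1n.
have uv i : u ord0 i <= v ord0 i by rewrite !mxE lerD2l; lra.
have vuv : (0 < vol R n (box u v))%E.
  rewrite vol_box// lte_fin; apply: prodr_gt0 => i _; rewrite !mxE.
  by rewrite opprD opprK addrACA subrr add0r -splitr.
have mB := measurable_box a b; have mu := measurable_box u v.
have mp : measurable_fun setT (EFin \o peval p).
  by apply/measurable_EFinP; exact: measurable_peval.
apply: (@lt_le_trans _ _ (e%:E * vol R n (box u v))%E); first exact: mule_gt0.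
rewrite -integral_cst//.
have uvB : box u v `<=` box a b by move=> y /uvU[/Uab].
apply: (@le_trans _ _ (\int[vol R n]_(x in box u v) (peval p x)%:E)%E).
  apply: ge0_le_integral => //.
  - by move=> y _; rewrite lee_fin ltW.
  - exact: measurable_funTS.
  - by move=> y /uvU[_ /ltW]; rewrite lee_fin.
apply: ge0_subset_integral => //; exact: measurable_funTS.
Qed.

End measurability.

(** * Attainment of the infimum *)

Section attainment.
Variables (R : realType) (n d : nat).

Let N := #|{: bmultinom n d.+1}|.
Let mono (i : 'I_N) : mpoly n R := mpolyX R (bmnm (enum_val i)).
Let poly_of (c : 'rV[R]_N) : mpoly n R := \sum_(i < N) c ord0 i *: mono i.

Let poly_of_Pd c : Pd d (poly_of c).
Proof.
rewrite /Pd /=; apply: leq_trans (msize_sum _ _ _) _.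
apply/bigmax_leqP => i _; apply: leq_trans (msizeZ_le _ _) _.
by rewrite msizeX bmdeg.
Qed.

Let poly_of_surj p : Pd d p -> exists c, poly_of c = p.
Proof.
rewrite /Pd /= => pd; exists (\row_i mcoeff (bmnm (enum_val i)) p).
rewrite [RHS](mpolywE pd) big_enum_val /=.
by apply: eq_bigr => i _; rewrite mxE.
Qed.

Let poly_ofZ k c : poly_of (k *: c) = k *: poly_of c.
Proof.
rewrite /poly_of scaler_sumr.
by apply: eq_bigr => i _; rewrite mxE scalerA.
Qed.

Let poly_of_eq0 c : poly_of c = 0 -> c = 0.
Proof.
move=> c0; apply/rowP => i; rewrite mxE.
have := congr1 (mcoeff (bmnm (enum_val i))) c0.
rewrite mcoeff0 raddf_sum (bigD1 i)//= mcoeffZ mcoeffX eqxx mulr1 big1 ?addr0//.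
move=> j /negPf ji; rewrite mcoeffZ mcoeffX (inj_eq val_inj).
by rewrite (inj_eq enum_val_inj) ji mulr0.
Qed.

Let peval_poly_of c x :
  peval (poly_of c) x = \sum_i c ord0 i * peval (mono i) x.
Proof. by rewrite peval_sum; under eq_bigr do rewrite pevalZ. Qed.

Let closed_feasible (A : set 'rV[R]_n) (t : R) :
  closed [set c | forall x, A x -> t <= peval (poly_of c) x].
Proof.
rewrite (_ : mkset _ =
    \bigcap_(x in A) [set c | t <= peval (poly_of c) x]); last by [].
apply: closed_bigI => x _.
have : continuous (fun c : 'rV[R]_N => \sum_i c ord0 i * peval (mono i) x).
  exact: linear_form_continuous.
move/continuous_closedP => /(_ _ (@closed_ge _ t)).
congr closed; apply/seteqP; split=> c /=; by rewrite peval_poly_of.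
Qed.

(** The interior of K is what makes the objective positive on the nonzero
   polynomials of the cone: it provides an open subset of the box. *)
Lemma w_star_attained (K : set 'rV[R]_n) (a b : 'rV[R]_n) :
  K° !=set0 -> K `<=` box a b ->
  exists2 p, w_feasible K (box a b) d p &
             w_objective (box a b) p = w_star K (box a b) d.
Proof.
move=> K0 Kab.
pose mu i := Rintegral (vol R n) (box a b) (peval (mono i)).
have muE c : w_objective (box a b) (poly_of c) = (\sum_i c ord0 i * mu i)%:E.
  by rewrite w_objectiveE Rintegral_peval_sum.
pose C := [set c | forall x, box a b x -> 0 <= peval (poly_of c) x].
pose F := C `&` [set c | forall x, K x -> 1 <= peval (poly_of c) x].
have feasF c : F c <-> w_feasible K (box a b) d (poly_of c).
  by split=> [[? ?]|[? ? ?]]; split=> //; exact: poly_of_Pd.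
have [c Fc cmin] : exists2 c, F c & forall c', F c' ->
    \sum_i c ord0 i * mu i <= \sum_i c' ord0 i * mu i.
  apply: (@linear_form_min R N mu C F).
  - exact: closed_feasible.
  - by move=> k c k0 Cc x /Cc; rewrite poly_ofZ pevalZ; exact: mulr_ge0.
  - move=> c Cc c0; rewrite -lte_fin -muE.
    apply: (w_objective_gt0 _ K0) => //; first exact: open_interior.
      by apply: subset_trans Kab; exact: interior_subset.
    by apply: contra_neq c0; exact: poly_of_eq0.
  - by apply: closedI; exact: closed_feasible.
  - have [|c c1] := @poly_of_surj 1; first by rewrite /Pd /= msize1.
    by exists c; split=> x _ /=; rewrite c1 -mpolyC1 pevalC.
  - by move=> c [].
exists (poly_of c); first exact/feasF.
apply/eqP; rewrite eq_le; apply/andP; split.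
  apply/ereal_infP => _ [q qf <-].
  have [c' c'q] : exists c', poly_of c' = q by case: qf => /poly_of_surj.
  by rewrite -c'q !muE lee_fin; apply: cmin; apply/feasF; rewrite c'q.
by apply: ereal_inf_lbound; exists (poly_of c) => //; exact/feasF.
Qed.

End attainment.

(** * Polynomial approximation of a step function from above *)

Section step_polynomial.
Variable R : realType.
Implicit Types (s t : R) (j : nat).

Lemma bernoulli_ge M s : 0 <= s <= 1 -> 1 - M%:R * s <= (1 - s) ^+ M.
Proof.
move=> /andP[s0 s1]; elim: M => [|M IHM]; first by rewrite mul0r subr0 expr0.
rewrite exprS -natr1; apply: (@le_trans _ _ ((1 - s) * (1 - M%:R * s))).
  by have := mulr_ge0 (ler0n R M) (mulr_ge0 s0 s0); lra.
by rewrite ler_wpM2l// subr_ge0.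
Qed.

Lemma bernoulli_le M s : 0 <= s <= 1 -> (1 - s) ^+ M * (1 + M%:R * s) <= 1.
Proof.
move=> /andP[s0 s1]; elim: M => [|M IHM]; first by rewrite mul0r addr0 expr0 mulr1.
apply: le_trans IHM; rewrite exprSr -mulrA ler_wpM2l ?exprn_ge0 ?subr_ge0//.
rewrite -natr1; have := mulr_ge0 (ler0n R M) (mulr_ge0 s0 s0).
have := mulr_ge0 s0 s0; lra.
Qed.

(** The exponents are chosen so that, with u = (1 - t) / 2, the Bernoulli quantity
   2 ^ (j^2 - j) * u ^ (j^2) equals 2 ^ -j * (2 u) ^ (j^2): it tends to 0 when
   u <= 1/2 and to infinity when u > 1/2. The added 2 ^ -j lifts the values at
   t >= 0 to at least 1. *)
Definition step j t : R :=
  (1 - ((1 - t) / 2) ^+ (j * j)) ^+ (2 ^ (j * j.-1)) + 2 ^- j.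

Lemma scale_half_expr j s :
  (2 ^ (j * j.-1))%:R * s ^+ (j * j) = 2 ^- j * (2 * s) ^+ (j * j).
Proof.
rewrite exprMn mulrA natrX; congr (_ * _).
case: j => [|j]; first by rewrite !expr0 invr1 mulr1.
rewrite -[in RHS](subnK (leq_pmulr j.+1 (ltn0Sn j))) exprD mulrCA mulVf ?mulr1.
  by rewrite mulnS addnC addnK /= mulnC.
by rewrite expf_neq0// pnatr_eq0.
Qed.

Lemma half_itv t : -1 <= t <= 1 -> 0 <= (1 - t) / 2 <= 1.
Proof. by move=> /andP[? ?]; apply/andP; split; lra. Qed.

Lemma step_base_itv j t : -1 <= t <= 1 -> 0 <= ((1 - t) / 2) ^+ (j * j) <= 1.
Proof. by move=> /half_itv/andP[? ?]; rewrite exprn_ge0// exprn_ile1. Qed.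

Lemma invpow2_ge0 j : (0 : R) <= 2 ^- j.
Proof. by rewrite invr_ge0 exprn_ge0. Qed.

Lemma invpow2_le1 j : (2 : R) ^- j <= 1.
Proof. by rewrite -exprVn exprn_ile1//; lra. Qed.

Lemma step_ge0 j t : -1 <= t <= 1 -> 0 <= step j t.
Proof.
move=> /(step_base_itv j)/andP[_ ?].
by rewrite addr_ge0 ?invpow2_ge0// exprn_ge0// subr_ge0.
Qed.

Lemma step_le j t : -1 <= t <= 1 -> step j t <= 1 + 2 ^- j.
Proof.
move=> /(step_base_itv j)/andP[? ?].
by rewrite lerD2r exprn_ile1 ?subr_ge0// gerBl.
Qed.

Lemma step_ge1 j t : 0 <= t <= 1 -> 1 <= step j t.
Proof.
move=> /andP[t0 t1]; have t11 : -1 <= t <= 1 by apply/andP; split; lra.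
rewrite /step -lerBlDr.
apply: le_trans (bernoulli_ge (2 ^ (j * j.-1)) (step_base_itv j t11)).
rewrite lerD2l lerN2 scale_half_expr ler_piMr ?invpow2_ge0//.
by rewrite exprn_ile1//; lra.
Qed.

(** For t < 0 the base w = 1 - t is greater than 1, so that w ^ j >= 4 for large j,
   and the Bernoulli quantity is then at least 2 ^ -j * 4 ^ j = 2 ^ j. *)
Lemma step_le_neg t : -1 <= t < 0 ->
  \forall j \near \oo, step j t <= 2 ^- j + 2 ^- j.
Proof.
move=> /andP[t1 t0]; have t11 : -1 <= t <= 1 by apply/andP; split; lra.
pose w := 1 - t; have w1 : 1 < w by rewrite /w; lra.
have : (w^-1 ^+ j) @[j --> \oo] --> (0 : R).
  by apply: cvg_expr; rewrite ger0_norm ?invf_lt1 ?invr_ge0//; lra.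
have h4 : (0 : R) < 4^-1 by rewrite invr_gt0.
move=> /cvgr_lt /(_ _ h4); apply: filterS => j wj.
have {}wj : 4 <= w ^+ j.
  by rewrite -lef_pV2 ?posrE ?exprn_gt0//; [rewrite -exprVn ltW|lra].
have := bernoulli_le (2 ^ (j * j.-1)) (step_base_itv j t11).
rewrite scale_half_expr -/w (_ : 2 * (w / 2) = w); last by field.
set y := 2 ^- j * _ => le1.
have yj : 2 ^+ j <= y.
  rewrite /y exprM mulrC ler_pdivlMr ?exprn_gt0// -exprMn.
  by rewrite lerXn2r ?nnegrE ?exprn_ge0//; lra.
have y0 : 0 < y by apply: lt_le_trans yj; rewrite exprn_gt0.
rewrite /step lerD2r -/w; apply: (@le_trans _ _ (1 + y)^-1).
  by rewrite -[leRHS]mul1r ler_pdivlMr//; lra.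
by rewrite lef_pV2 ?posrE ?exprn_gt0//; lra.
Qed.

Lemma invpow2_cvg0 : (2 ^- j : R) @[j --> \oo] --> (0 : R).
Proof.
rewrite (_ : (fun j => _) = (fun j => (2^-1 : R) ^+ j)).
  by apply: cvg_expr; rewrite ger0_norm; lra.
by apply/funext => j; rewrite exprVn.
Qed.

Lemma step_cvg t : -1 <= t <= 1 -> step j t @[j --> \oo] --> ((0 <= t)%R%:R : R).
Proof.
move=> t11; have [t0|t0] := leP 0 t.
  apply: (@squeeze_cvgr _ _ _ _ (fun=> 1) (fun j => 1 + 2 ^- j)).
  - near=> j; rewrite step_le// step_ge1//.
    by case/andP: t11 => _ ->; rewrite t0.
  - exact: cvg_cst.
  - rewrite -[X in _ --> X]addr0; apply: cvgD; first exact: cvg_cst.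
    exact: invpow2_cvg0.
apply: (@squeeze_cvgr _ _ _ _ (fun=> 0) (fun j => 2 ^- j + 2 ^- j)).
- have : -1 <= t < 0 by case/andP: t11 => -> _.
  by move=> /step_le_neg; apply: filterS => j ->; rewrite step_ge0.
- exact: cvg_cst.
- rewrite -[X in _ --> X]addr0; apply: cvgD; exact: invpow2_cvg0.
Unshelve. all: by end_near. Qed.

Lemma cvg_prod_seq (I : Type) (r : seq I) (f : I -> nat -> R) (l : I -> R) :
  (forall i, f i j @[j --> \oo] --> l i) ->
  \prod_(i <- r) f i j @[j --> \oo] --> \prod_(i <- r) l i.
Proof.
move=> fl; elim: r => [|i r IHr].
  rewrite big_nil (_ : (fun j => _) = cst 1); first exact: cvg_cst.
  by apply/funext => j; rewrite big_nil.
rewrite big_cons (_ : (fun j => _) = f i \* (fun j => \prod_(i <- r) f i j)).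
  exact: (cvgM (fl i) IHr).
by apply/funext => j; rewrite big_cons.
Qed.

End step_polynomial.

(** * Outer approximation of a semialgebraic set *)

Section outer_approximation.
Variables (R : realType) (n m : nat).
Variables (g : 'I_m -> mpoly n R) (a b : 'rV[R]_n).
Local Notation K := (semialg g).
Local Notation B := (box a b).

Definition step_poly (j : nat) (h : mpoly n R) : mpoly n R :=
  (1 - (2^-1 *: (1 - h)) ^+ (j * j)) ^+ (2 ^ (j * j.-1)) + mpolyC n (2 ^- j).

Lemma peval_step_poly j h x : peval (step_poly j h) x = step j (peval h x).
Proof.
have p1 : peval (1 : mpoly n R) x = 1 by rewrite -mpolyC1 pevalC.
by rewrite pevalD pevalC pevalXn pevalB pevalXn pevalZ pevalB p1 mulrC.
Qed.

(** The factor of index i is the step polynomial of the i-th constraint divided by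
   a bound M i of its absolute value on the box, which does not change its sign. *)
Lemma outer_approximation : exists P : nat -> mpoly n R,
  [/\ forall j x, B x -> 0 <= peval (P j) x <= 2 ^+ m,
      forall j x, B x -> K x -> 1 <= peval (P j) x
    & forall x, B x -> peval (P j) x @[j --> \oo] --> (\1_K x : R)].
Proof.
have /choice[M HM] : forall i, exists M : R, 0 < M /\
    forall x, B x -> `|peval (g i) x| <= M.
  by move=> i; have [M] := bounded_peval_box a b (g i); exists M.
pose h i := (M i)^-1 *: g i.
have hE i x : peval (h i) x = (M i)^-1 * peval (g i) x by rewrite pevalZ.
have h1 i x : B x -> -1 <= peval (h i) x <= 1.
  have [Mi giM] := HM i; move=> /giM gx.
  by rewrite -ler_norml hE normrM gtr0_norm ?invr_gt0// ler_pdivrMl// mulr1.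
have h0 i x : (0 <= peval (h i) x) = (0 <= peval (g i) x).
  by rewrite hE pmulr_rge0// invr_gt0; case: (HM i).
exists (fun j => \prod_(i < m) step_poly j (h i)); split.
- move=> j x Bx; rewrite peval_prod; apply/andP; split.
    by apply: prodr_ge0 => i _; rewrite peval_step_poly step_ge0// h1.
  rewrite -[m in 2 ^+ m]card_ord -prodr_const; apply: ler_prod => i _.
  rewrite peval_step_poly step_ge0 ?h1//=.
  by rewrite (le_trans (step_le j (h1 i x Bx)))// lerD2l invpow2_le1.
- move=> j x Bx Kx; rewrite peval_prod.
  rewrite [leLHS](_ : 1 = \prod_(i < m) (1 : R)); last by rewrite big1.
  apply: ler_prod => i _.
  rewrite ler01 peval_step_poly step_ge1// h0 Kx.
  by case/andP: (h1 i x Bx).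
- move=> x Bx.
  have -> : \1_K x = \prod_(i < m) (0 <= peval (h i) x)%R%:R :> R.
    rewrite indicE; have [/set_mem Kx|/negP nKx] := boolP (x \in K).
      by rewrite big1// => i _; rewrite h0 Kx.
    have [i gi] : exists i, ~~ (0 <= peval (g i) x).
      apply: contrapT => /forallNP H; apply: nKx; apply/mem_set => i.
      by have /negP := H i; rewrite negbK.
    by rewrite (bigD1 i)//= h0 (negPf gi) mul0r.
  rewrite (_ : (fun j => _) = fun j => \prod_(i < m) step j (peval (h i) x)).
    by apply: cvg_prod_seq => i; exact/step_cvg/h1.
  apply/funext => j; rewrite peval_prod.
  by apply: eq_bigr => i _; rewrite peval_step_poly.
Qed.

Lemma w_objective_cvg (P : nat -> mpoly n R) (c : R) : K `<=` B ->
  (forall j x, B x -> 0 <= peval (P j) x <= c) ->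
  (forall x, B x -> peval (P j) x @[j --> \oo] --> (\1_K x : R)) ->
  w_objective B (P j) @[j --> \oo] --> vol R n K.
Proof.
move=> KB Pc PK; have mB := measurable_box a b; have mK := measurable_semialg g.
have -> : vol R n K = (\int[vol R n]_(x in B) (\1_K x)%:E)%E.
  by rewrite integral_indic// setIidl.
have [|||||_ _] := @dominated_convergence _ _ R (vol R n) B mB
  (fun j x => (peval (P j) x)%:E) (fun x => (\1_K x)%:E) (cst c%:E).
- by move=> j; apply/measurable_EFinP; apply: measurable_funTS; exact: measurable_peval.
- by apply/measurable_EFinP; apply: measurable_funTS; exact/measurable_indicP.
- by apply/aeW => x Bx; apply: cvg_EFin; [exact: nearW|exact: PK].
- have := integrable_peval a b (mpolyC n c).
  by rewrite (funext (pevalC c)).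
- by apply/aeW => x j Bx; rewrite lee_fin; case/andP: (Pc j x Bx) => /ger0_norm ->.
by [].
Qed.

End outer_approximation.

(** * The optimal values *)

Section values.
Variables (R : realType) (n : nat) (K : set 'rV[R]_n) (a b : 'rV[R]_n).
Local Open Scope ereal_scope.
Local Notation B := (box a b).

Lemma w_feasible_le d e p : (d <= e)%N ->
  w_feasible K B d p -> w_feasible K B e p.
Proof. by move=> de [pd ? ?]; split=> //; exact: leq_trans pd _. Qed.

Lemma w_star_nonincreasing d e : (d <= e)%N -> w_star K B e <= w_star K B d.
Proof.
move=> de; apply/ereal_infP => _ [p pf <-].
by apply: ereal_inf_lbound; exists p => //; exact: w_feasible_le pf.
Qed.

Lemma w_feasible_superlevel d p : K `<=` B -> w_feasible K B d p ->
  K `<=` superlevel B p.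
Proof. by move=> KB [_ _ p1] x Kx; split; [exact: KB|exact: p1]. Qed.

Lemma v_star_le_w_star d : K `<=` B -> v_star K B d <= w_star K B d.
Proof.
move=> KB; apply/ereal_infP => _ [p pf <-].
apply: le_trans (vol_superlevel_le _); last by case: pf.
apply: ereal_inf_lbound; exists p => //; split; first by case: pf.
exact: w_feasible_superlevel pf.
Qed.

Lemma vol_le_v_star d : measurable K -> vol R n K <= v_star K B d.
Proof.
move=> mK; apply/ereal_infP => _ [p [_ Kp] <-].
by apply: le_measure; rewrite ?inE//; exact: measurable_superlevel.
Qed.

End values.

(** A nonincreasing sequence tends to its infimum. All values are at least vol K,
   and they come arbitrarily close to it: each approximating polynomial is feasible
   for d equal to its size. *)
Lemma w_star_cvg (R : realType) (n m : nat) (g : 'I_m -> mpoly n R)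
    (a b : 'rV[R]_n) : semialg g `<=` box a b ->
  (w_star (semialg g) (box a b) d @[d --> \oo] --> vol R n (semialg g))%E.
Proof.
move=> KB; set K := semialg g; set B := box a b.
have mK : measurable K by exact: measurable_semialg.
have [P [P0 P1 PK]] := outer_approximation g a b.
have -> : vol R n K = ereal_inf (range (w_star K B)).
  apply/eqP; rewrite eq_le; apply/andP; split.
    apply/ereal_infP => _ [d _ <-].
    exact: le_trans (vol_le_v_star _ _ _ mK) (v_star_le_w_star _ KB).
  apply: cvge_ge (w_objective_cvg KB P0 PK); apply: nearW => j.
  apply: (@le_trans _ _ (w_star K B (msize (P j)))).
    by apply: ereal_inf_lbound; exists (msize (P j)).
  apply: ereal_inf_lbound; exists (P j) => //; split.
  - exact: leqnSn.
  - by move=> x /(P0 j)/andP[].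
  - by move=> x Kx; apply: P1 => //; exact: KB.
by apply: ereal_nonincreasing_cvgn => d e de; exact: w_star_nonincreasing.
Qed.

Local Open Scope ereal_scope.

Theorem theorem2 (R : realType) (n m : nat) (g : 'I_m -> mpoly n R)
    (a b : 'rV[R]_n) (K_compact : compact (semialg g))
    (K_interior : (semialg g)° !=set0) (K_box : semialg g `<=` box a b) :
  [/\ forall d : nat,
        (exists p : mpoly n R,
           [/\ w_feasible (semialg g) (box a b) d p,
               w_objective (box a b) p = w_star (semialg g) (box a b) d
             & semialg g `<=` superlevel (box a b) p]) /\
        v_star (semialg g) (box a b) d <= w_star (semialg g) (box a b) d,
      forall d : nat,
        w_star (semialg g) (box a b) d.+1 <= w_star (semialg g) (box a b) d,
      w_star (semialg g) (box a b) d @[d --> \oo] --> vol R n (semialg g)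
    & v_star (semialg g) (box a b) d @[d --> \oo] --> vol R n (semialg g)].
Proof.
have wcvg := w_star_cvg K_box.
split=> // [d|d|].
- split; last exact: v_star_le_w_star.
  have [p pf pw] := w_star_attained d K_interior K_box.
  by exists p; split=> //; exact: w_feasible_superlevel pf.
- exact: w_star_nonincreasing.
- apply: (squeeze_cvge _ (cvg_cst (vol R n (semialg g))) wcvg).
  apply: nearW => d; rewrite v_star_le_w_star// andbT.
  by apply: vol_le_v_star; exact: measurable_semialg.
Qed.
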